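(* Let $I$ be a non-trivial admissible ideal in $\mathbb{N}$. If $x=\{x_k\}_{k\in\mathbb{N}}$ and $y=\{y_k\}_{k\in\mathbb{N}}$ are sequences of real numbers such that $d_I(\{k\in\mathbb{N}:x_k\neq y_k\})=0$, then $\Lambda_x^S(I)=\Lambda_y^S(I)$ and $\Gamma_x^S(I)=\Gamma_y^S(I)$.
   Context: $\mathbb{N}$ is the set of positive integers. An ideal $I$ in $\mathbb{N}$ is a class of subsets of $\mathbb{N}$ containing $\emptyset$ and closed under finite unions and under taking subsets; it is non-trivial if $\mathbb{N}\notin I$ and admissible if $\{n\}\in I$ for every $n\in\mathbb{N}$. A real sequence $\{a_n\}$ is $I$-convergent to $a$ ($I\text{-}\lim a_n=a$) if $\{n:|a_n-a|\ge\varepsilon\}\in I$ for every $\varepsilon>0$. For $K\subset\mathbb{N}$, the $I$-asymptotic density is $d_I(K)=I\text{-}\lim_{n\to\infty}\frac{|\{j\in K:j\le n\}|}{n}$, when this $I$-limit exists. ''$K$ does not have $I$-asymptotic density zero'' means that it is not the case that $d_I(K)$ exists and equals $0$ (so either $d_I(K)$ is positive or $d_I(K)$ does not exist). For an infinite set $A=\{k_1<k_2<\cdots\}\subset\mathbb{N}$, the subsequence $\{x_{k_j}\}_{j\in\mathbb{N}}$ is called $I$-nonthin if $A$ does not have $I$-asymptotic density zero. For a real sequence $x$: a real number $l$ is an $I$-statistical limit point of $x$ if some $I$-nonthin subsequence of $x$ converges (in the ordinary sense) to $l$; $\Lambda_x^S(I)$ is the set of all such $l$. A real number $\gamma$ is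 an $I$-statistical cluster point of $x$ if for every $\varepsilon>0$ the set $\{k\in\mathbb{N}:|x_k-\gamma|<\varepsilon\}$ does not have $I$-asymptotic density zero; $\Gamma_x^S(I)$ is the set of all such $\gamma$. *)

(* Defs.v *)
From HB Require Import structures.
From mathcomp Require Import all_boot all_order all_algebra finmap.
From mathcomp Require Import all_classical all_reals all_analysis.
Set Implicit Arguments.
Unset Strict Implicit.
Unset Printing Implicit Defensive.
Import Order.TTheory GRing.Theory Num.Theory numFieldNormedType.Exports.
Local Open Scope classical_set_scope.
Local Open Scope ring_scope.

(* [nat] contains 0, so the positive integers get a type of their own; 0 is not
   available as an index of a sequence or as an element of a set in an ideal. *)
Record posnat : Type := PosNat {
  posnat_val :> nat;
  posnat_gt0 : (0 < posnat_val)%N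
}.

HB.instance Definition _ := [isSub for posnat_val].
HB.instance Definition _ := [Countable of posnat by <:].

Section Ideals.
Variable T : Type.
Implicit Type I : set (set T).

Definition is_ideal I : Prop :=
  [/\ I set0,
      (forall A B : set T, I A -> I B -> I (A `|` B)) &
      (forall A B : set T, A `<=` B -> I B -> I A)].

Definition nontrivial_ideal I : Prop := ~ I setT.

Definition admissible_ideal I : Prop := forall t : T, I [set t].

End Ideals.

Section IStatistical.
Variables (R : realType) (I : set (set posnat)).
Implicit Types (a x : posnat -> R) (K : set posnat).

Definition I_lim a (l : R) : Prop :=
  forall e : R, 0 < e -> I [set n | e <= `|a n - l|].

(* The set being counted is finite, so [fset_set] does not collapse to the
   default value that it takes on infinite sets. *)
Definition density_ratio K (n : posnat) : R :=
  #|` fset_set [set j : posnat | K j /\ (j <= n)%N]|%:R / n%:R.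

(* "d_I(K) exists and equals d"; a relation, as the I-limit need not exist. *)
Definition I_density K (d : R) : Prop := I_lim (density_ratio K) d.

(* The increasing enumeration k 0 < k 1 < ... of an infinite set [range k]
   starts at index 0 so as to use the filter [\oo] on [nat]. *)
Definition I_stat_limit_point x (l : R) : Prop :=
  exists k : nat -> posnat,
    [/\ (forall i j : nat, (i < j)%N -> (k i < k j)%N),
        ~ I_density (range k) 0 &
        x (k j) @[j --> \oo] --> l].

Definition I_stat_cluster_point x (g : R) : Prop :=
  forall e : R, 0 < e -> ~ I_density [set k | `|x k - g| < e] 0.

Definition Lambda_S x : set R := [set l | I_stat_limit_point x l].

Definition Gamma_S x : set R := [set g | I_stat_cluster_point x g].

End IStatistical.

(* Main.v *)
(** If [A] is covered by [B] and [C], then the density ratio of [A] is at most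
    the sum of those of [B] and [C]; hence sets of [I]-density zero form an
    ideal, which contains the finite sets when [I] is admissible. Consequently
    a set which is not of [I]-density zero stays so after removing the set
    where [x] and [y] differ. In particular what remains is infinite, so that
    it can be enumerated increasingly as a nonthin subsequence on which [x]
    and [y] agree. *)
Require Import Defs.
From mathcomp Require Import all_boot all_order all_algebra.
From mathcomp Require Import finmap.
From mathcomp Require Import all_classical all_reals all_analysis.
Import Order.TTheory GRing.Theory Num.Theory.
Local Open Scope classical_set_scope.
Local Open Scope ring_scope.

(** Since [A] is unbounded, each [n] has a least element [next n] of [A] that is at least [n]; [h]
    iterates this from 0, restarting just above the last value found. *)
Lemma infinite_nat_enumeration (A : set nat) : infinite_set A ->
  exists2 h : nat -> nat,
    (forall i j, (i < j)%N -> (h i < h j)%N) & range h = A.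
Proof.
move=> Ainf.
have exA n : exists m, `[< A m >] && (n <= m)%N.
  apply: contrapT => /forallNP nA; apply: Ainf.
  apply: sub_finite_set (finite_II n) => m Am /=.
  rewrite ltnNge; apply/negP => nm; apply: (nA m).
  by apply/andP; split=> //; exact/asboolP.
pose next n := ex_minn (exA n).
have nextA n : A (next n) by rewrite /next; case: ex_minnP => m /andP[/asboolP].
have next_ge n : (n <= next n)%N by rewrite /next; case: ex_minnP => m /andP[].
have next_le n m : A m -> (n <= m)%N -> (next n <= m)%N.
  move=> Am nm; rewrite /next; case: ex_minnP => p _; apply.
  by rewrite nm andbT; exact/asboolP.
pose h := fix h i := if i is j.+1 then next (h j).+1 else next 0%N.
have hS i : (h i < h i.+1)%N by exact: next_ge.
have h_incr : {homo h : i j / (i < j)%N} by apply: homo_ltn => //; exact: ltn_trans.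
have h_ge i : (i <= h i)%N by elim: i => // i IH; exact: leq_ltn_trans IH (hS i).
exists h; first exact: h_incr.
apply/seteqP; split=> [_ [[|i] _ <-]|a Aa]; try exact: nextA.
(* The first index [i] with [a <= h i] attains [a]: the previous value, if any, lies below [a], so
   the minimality of [next] gives [h i <= a]. *)
have exh : exists i, (a <= h i)%N by exists a.
have [[|i] ahi imin] := ex_minnP exh.
  by exists 0%N => //; apply/eqP; rewrite eqn_leq ahi andbT; exact: next_le.
exists i.+1 => //; apply/eqP; rewrite eqn_leq ahi andbT; apply: next_le => //.
by rewrite ltnNge; apply/negP => /imin; rewrite ltnn.
Qed.

Lemma finite_posnat_le (n : nat) : finite_set [set j : posnat | (j <= n)%N].
Proof.
apply: (@finite_preimage _ _ `I_n.+1 posnat_val); last exact: finite_II.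
by move=> i j _ _; exact: val_inj.
Qed.

Lemma ideal_finite (T : Type) (I : set (set T)) (A : set T) :
  is_ideal I -> admissible_ideal I -> finite_set A -> I A.
Proof.
(* A classical choice structure on [T] provides the decidable equality needed to list [A] as a
   sequence. *)
elim/Pchoice: T => T in I A *.
case=> I0 IU _ Iadm /finite_seqP[s ->]; elim: s => [|t s IH].
  by rewrite set_nil.
have -> : [set` t :: s] = [set t] `|` [set` s].
  by apply/seteqP; split=> u /=; rewrite in_cons => /predU1P.
exact: IU.
Qed.

Section Density.
Variables (R : realType) (I : set (set posnat)).
Hypothesis hI : is_ideal I.

Lemma finite_density_prefix (K : set posnat) (n : nat) :
  finite_set [set j : posnat | K j /\ (j <= n)%N].
Proof. by apply: sub_finite_set (finite_posnat_le n) => j []. Qed.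

Lemma density_ratio_ge0 (K : set posnat) (n : posnat) :
  0 <= density_ratio R K n.
Proof. by rewrite /density_ratio divr_ge0. Qed.

Lemma density_ratio_sub_setU (A B C : set posnat) (n : posnat) :
  A `<=` B `|` C ->
  density_ratio R A n <= density_ratio R B n + density_ratio R C n.
Proof.
move=> ABC; rewrite /density_ratio -mulrDl ler_wpM2r ?invr_ge0//.
rewrite -natrD ler_nat; apply: leq_trans (fsubset_leq_card _) (leq_card_fsetU _ _).
rewrite -fset_setU; try exact: finite_density_prefix.
rewrite -fset_set_sub; first by move=> j [/ABC[]]; [left|right].
- exact: finite_density_prefix.
- by rewrite finite_setU; split; exact: finite_density_prefix.
Qed.

(** Where the ratio of [A] is at least [e], that of [B] or that of [C] is at least [e / 2]. *)
Lemma I_density0_sub_setU (A B C : set posnat) : A `<=` B `|` C ->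
  I_density I B (0 : R) -> I_density I C (0 : R) -> I_density I A (0 : R).
Proof.
case: hI => _ IU Isub ABC dB dC e e0.
have e2 : 0 < e / 2 by rewrite divr_gt0.
apply: Isub (IU _ _ (dB _ e2) (dC _ e2)) => n /=.
rewrite !subr0 !ger0_norm ?density_ratio_ge0// => eA.
have [|ltB] := leP (e / 2) (density_ratio R B n); first by left.
right; rewrite leNgt; apply/negP => ltC.
have := le_trans eA (density_ratio_sub_setU _ _ _ n ABC).
by rewrite leNgt [e]splitr ltrD.
Qed.

Lemma I_density0_finite (K : set posnat) :
  admissible_ideal I -> finite_set K -> I_density I K (0 : R).
Proof.
move=> Iadm finK e e0; apply: ideal_finite => //.
pose N := #|` fset_set K|.
(* At most [N] elements are ever counted, so a ratio of at least [e] at [n] forces [e * n <= N],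
   which bounds [n]. *)
apply: sub_finite_set (finite_posnat_le (Num.trunc (N%:R / e))) => n /=.
have n0 : 0 < (n%:R : R) by rewrite ltr0n posnat_gt0.
rewrite subr0 ger0_norm ?density_ratio_ge0// => en.
rewrite truncn_ge_nat ?divr_ge0 ?(ltW e0)// ler_pdivlMr// mulrC.
move: en; rewrite /density_ratio ler_pdivlMr// => /le_trans; apply.
rewrite ler_nat fsubset_leq_card// -fset_set_sub//; last exact: finite_density_prefix.
by move=> j [].
Qed.

Lemma Lambda_S_sub (x y : posnat -> R) : admissible_ideal I ->
  I_density I [set k | x k <> y k] (0 : R) -> Lambda_S I x `<=` Lambda_S I y.
Proof.
move=> Iadm dxy l [k [k_incr nk kl]].
pose J := [set j | x (k j) = y (k j)].
have kJ : ~ I_density I (k @` J) (0 : R).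
  move=> dkJ; apply: nk; apply: I_density0_sub_setU dkJ dxy => _ [j _ <-].
  by have [e|ne] := pselect (x (k j) = y (k j)); [left; exists j|right].
have [|h h_incr hJ] := @infinite_nat_enumeration J.
  by move=> finJ; apply: kJ; apply: I_density0_finite => //; exact: finite_image.
exists (k \o h); split => [i j ij||].
- by apply: k_incr; exact: h_incr.
- by rewrite -(image_comp h k) hJ.
have -> : (fun j => y ((k \o h) j)) = (x \o k) \o h.
  apply/funext => j /=; have : J (h j) by rewrite -hJ; exists j.
  by [].
(* A strictly increasing [h] satisfies [n <= h n], hence tends to infinity. *)
apply: cvg_comp kl; apply/cvgnyPge => A; exists A => // n /= An.
apply: leq_trans An _; elim: n => // n IH.
by apply: leq_ltn_trans IH _; exact: h_incr.
Qed.

(** For the same [e], the indices where [x] is [e]-close to [g] are covered by those where [y] is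
    and those where [x] and [y] differ. *)
Lemma Gamma_S_sub (x y : posnat -> R) :
  I_density I [set k | x k <> y k] (0 : R) -> Gamma_S I x `<=` Gamma_S I y.
Proof.
move=> dxy g gx e e0 dy; apply: (gx e e0).
apply: I_density0_sub_setU dy dxy => k /= xk.
by have [<-|ne] := pselect (x k = y k); [left|right].
Qed.

End Density.

Theorem theorem3p2 (R : realType) (I : set (set posnat))
    (hI : is_ideal I) (hnt : nontrivial_ideal I) (hadm : admissible_ideal I)
    (x y : posnat -> R)
    (hxy : I_density I [set k : posnat | x k <> y k] (0 : R)) :
  Lambda_S I x = Lambda_S I y /\ Gamma_S I x = Gamma_S I y.
Proof.
have hyx : I_density I [set k | y k <> x k] (0 : R).
  suff -> : [set k | y k <> x k] = [set k | x k <> y k] by [].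
  by apply/seteqP; split=> k /= /nesym.
split; apply/seteqP; split; by [exact: Lambda_S_sub|exact: Gamma_S_sub].
Qed.
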